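(* Let $\kappa$ be a cardinal and let $L\subseteq\mathbb R^\kappa$ be a compact convex set which, as a topological space, satisfies the countable chain condition. Then there exists a zero-dimensional compact space $K$ belonging to $\mathrm{WRNB}^\perp$ and a continuous surjection from $K$ onto $L$.
   Context: A space is ccc if it contains no uncountable family of pairwise disjoint nonempty open sets. A compact space is weakly Radon-Nikodým (WRN) if it is homeomorphic to a weak$^*$ compact subset of the dual $X^*$ of a Banach space $X$ containing no isomorphic copy of $\ell_1$; a Boolean algebra is WRN if its Stone space is WRN. A zero-dimensional compact space belongs to $\mathrm{WRNB}^\perp$ if its Boolean algebra of clopen sets contains no uncountable subalgebra which is WRN. *)

(* Defs.v *)
From HB Require Import structures.
From mathcomp Require Import all_boot all_order all_algebra.
From mathcomp Require Import all_classical all_reals all_analysis.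
Set Implicit Arguments. Unset Strict Implicit. Unset Printing Implicit Defensive.
Import Order.TTheory GRing.Theory Num.Theory.
Import numFieldNormedType.Exports.
Local Open Scope classical_set_scope.
Local Open Scope ring_scope.

Definition compact_space (K : topologicalType) : Prop :=
  hausdorff_space K /\ compact [set: K].

Definition zero_dim (K : topologicalType) : Prop :=
  forall (U : set K) (x : K), open U -> U x ->
    exists V : set K, clopen V /\ V x /\ V `<=` U.

Definition ccc_set (T : topologicalType) (S : set T) : Prop :=
  forall F : set (set T),
    (forall U, F U -> U !=set0 /\ exists V, open V /\ U = S `&` V) ->
    (forall U W, F U -> F W -> U <> W -> U `&` W = set0) ->
    countable F.

Definition l1 (R : realType) : set (nat -> R) :=
  [set u : nat -> R | cvgn (series (fun k => `|u k| : R))].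
Definition l1norm (R : realType) (u : nat -> R) : R :=
  limn (series (fun k => `|u k| : R)).

Definition contains_l1 (R : realType) (X : normedModType R) : Prop :=
  exists (T : (nat -> R) -> X) (c C : R), 0 < c /\ 0 < C /\
    (forall (a : R) (u v : nat -> R), l1 u -> l1 v ->
       T (fun k => a * u k + v k) = a *: T u + T v) /\
    (forall u, l1 u -> c * l1norm u <= `|T u| <= C * l1norm u).

(* Elements of the dual X^* (continuous linear functionals), seen as points of
   R^X; the weak* topology on X^* is the subspace topology of {ptws X -> R}. *)
Definition dual_elt (R : realType) (X : normedModType R) (f : X -> R) : Prop :=
  (forall x y : X, f (x + y) = f x + f y) /\
  (forall (a : R) (x : X), f (a *: x) = a * f x) /\
  continuous f.

Definition WRN_set (R : realType) (T : topologicalType) (S : set T) : Prop :=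
  exists (X : completeNormedModType R) (f : T -> {ptws X -> R})
         (g : {ptws X -> R} -> T),
    ~ contains_l1 X /\
    (forall x, S x -> dual_elt (f x : X -> R)) /\
    compact (f @` S) /\
    {within S, continuous f} /\
    {within f @` S, continuous g} /\
    (forall x, S x -> g (f x) = x).

Definition clopen_subalgebra (K : topologicalType) (B : set (set K)) : Prop :=
  B `<=` clopen /\ B set0 /\ B setT /\
  (forall b, B b -> B (~` b)) /\
  (forall b c, B b -> B c -> B (b `|` c)) /\
  (forall b c, B b -> B c -> B (b `&` c)).

(* Stone space of a Boolean algebra B of subsets of K: the two-valued
   homomorphisms B -> 2 with the topology of pointwise convergence
   (encoded as functions on set K that vanish outside B). *)
Definition stone_space (K : topologicalType) (B : set (set K))
    : set {ptws set K -> bool} :=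
  [set h | h setT = true /\
           (forall b, B b -> h (~` b) = ~~ h b) /\
           (forall b c, B b -> B c -> h (b `|` c) = h b || h c) /\
           (forall b c, B b -> B c -> h (b `&` c) = h b && h c) /\
           (forall b, ~ B b -> h b = false)].

Definition WRN_BA (R : realType) (K : topologicalType) (B : set (set K)) : Prop :=
  WRN_set R (stone_space B).

Definition WRNB_perp (R : realType) (K : topologicalType) : Prop :=
  forall B : set (set K), clopen_subalgebra B -> WRN_BA R B -> countable B.

(* Main.v *)
Require Import Defs.
From HB Require Import structures.
From mathcomp Require Import all_boot all_order all_algebra.
From mathcomp Require Import all_classical all_reals all_analysis.
From mathcomp Require Import ring lra.
Import Order.TTheory GRing.Theory Num.Theory.
Import numFieldNormedType.Exports.
Local Open Scope classical_set_scope.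
Local Open Scope ring_scope.
Set Implicit Arguments.
Unset Strict Implicit.
Unset Printing Implicit Defensive.

(* Idea. Write each coordinate of a point of [L] in an expansion with two digits
   whose intervals shrink by the factor 2/3 only, so that the two halves of every
   interval overlap, and let [K] be the closure of the set of digit arrays that
   code points of [L] with every coordinate strictly inside all its intervals.
   On these arrays decoding is an open map, and [L] intersected with a box is
   convex, hence connected. So a clopen set of [K] not determined by finitely many
   given digits splits some fibre of the decoding: it contains one code of a point
   of [L] and misses another code of the same point.

   Let uncountably many clopen sets of [K] be separated from their complements
   by elements of a Banach space acting on [K]. By a Delta-system argument
   their supports may be assumed disjoint outside a finite set of coordinates.
   By ccc there is an infinite sequence of them such that any finitely many of the
   associated open sets of points with split fibre have a common point [y] of [L];
   since the digits of the coordinates of [y] can be chosen independently,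
   the sequence is independent, and Rosenthal's inequality yields a copy of l1. *)

(** * Uncountable families *)

Lemma uncountable_pigeonhole (T : Type) (U : countType) (A : set T) (f : T -> U) :
  ~ countable A -> exists u, ~ countable (A `&` [set a | f a = u]).
Proof.
move=> ncA; apply/existsNP => cA; apply: ncA.
apply: (@sub_countable _ _ A (\bigcup_u (A `&` [set a | f a = u]))).
  by apply: subset_card_le => a Aa; exists (f a).
by apply: bigcup_countable.
Qed.

Lemma uncountable_setD (T : Type) (A B : set T) :
  ~ countable A -> countable B -> ~ countable (A `\` B).
Proof.
move=> ncA cB cAB; apply: ncA.
apply: (@sub_countable _ _ A (\bigcup_(b in [set: bool]) if b then A `\` B else B)).
  apply: subset_card_le => a Aa; have [Ba|nBa] := pselect (B a).
    by exists false.
  by exists true.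
by apply: bigcup_countable => // -[].
Qed.

(** A weak Delta-system, by induction on [m]: if some index lies in uncountably many supports, keep
    those, move the index into [D] and delete it; otherwise stop. Disjointness outside [D] is
    arranged later, by discarding countably many sets at each choice. *)
Lemma delta_system (T : Type) (I : eqType) (F : T -> seq I) (m : nat) (A : set T) :
  (forall a, A a -> (size (F a) <= m)%N) -> ~ countable A ->
  exists (D : seq I) (A' : set T), A' `<=` A /\ ~ countable A' /\
    forall i, i \notin D -> countable (A' `&` [set a | i \in F a]).
Proof.
elim: m F A => [|m IH] F A sF ncA.
  exists [::], A; split => //; split => // i _.
  rewrite (_ : _ `&` _ = set0)//; apply/seteqP; split => // a [/sF + /=].
  by rewrite leqn0 size_eq0 => /eqP ->.
have [[i ncAi]|cAi] := pselect (exists i, ~ countable (A `&` [set a | i \in F a])); last first.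
  exists [::], A; split => //; split => // i _; apply: contrapT => ?.
  by apply: cAi; exists i.
have [|D [A' [A'A [ncA' cA']]]] := IH (fun a => [seq j <- F a | j != i]) _ _ ncAi.
  move=> a [Aa iFa]; rewrite size_filter -ltnS; apply: (leq_trans _ (sF a Aa)).
  rewrite -[in leqRHS](count_predC (pred1 i) (F a)) -addn1 addnC leq_add2r.
  by rewrite -has_count; apply/hasP; exists i => /=.
exists (i :: D), A'; split; first by move=> a /A'A [].
split => // j; rewrite inE negb_or => /andP[ji /cA'].
congr (countable (_ `&` _)).
by apply/seteqP; split => a /=; rewrite mem_filter /= ji.
Qed.

(** [ccc_set] concerns a set of sets, not an indexed family; nonempty disjoint traces are distinct,
    so the indexing is injective on [D]. *)
Lemma ccc_disjoint_countable (T : topologicalType) (L : set T) (J : Type)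
    (U : J -> set T) (D : set J) : ccc_set L ->
  (forall a, D a -> open (U a) /\ (L `&` U a) !=set0) ->
  trivIset D (fun a => L `&` U a) -> countable D.
Proof.
move=> cccL UD tD; have cV : countable ((fun a => L `&` U a) @` D).
  apply: cccL => [_ [a Da <-]|_ _ [a Da <-] [b Db <-] nab].
    by have [oU nU] := UD a Da; split => //; exists (U a).
  apply/eqP; apply: contrapT => /negP/set0P nab0; apply: nab.
  by rewrite (tD a b Da Db nab0).
move: cV; rewrite (eq_countable (inj_card_eq _))// => a b /set_mem Da /set_mem Db ab.
by apply: (tD a b Da Db); rewrite -ab setIid; exact: (UD a Da).2.
Qed.

(* Otherwise a maximal subfamily with disjoint traces on [L] is countable, and
   each of its members meets only countably many others, so [A] is countable. *)
Lemma ccc_uncountable_meet (T : topologicalType) (L : set T) (J : Type)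
    (U : J -> set T) (A : set J) : ccc_set L ->
  (forall a, A a -> open (U a) /\ (L `&` U a) !=set0) -> ~ countable A ->
  exists2 a, A a & ~ countable [set b | A b /\ (L `&` (U a `&` U b)) !=set0].
Proof.
move=> cccL UA ncA; apply: contrapT => h.
have {}h a : A a -> countable [set b | A b /\ (L `&` (U a `&` U b)) !=set0].
  by move=> Aa; apply: contrapT => ?; apply: h; exists a.
have [D [DA tD maxD]] := ex_maximal_disjoint_subcollection (fun a => L `&` U a) A.
apply: ncA; pose M a := [set b | A b /\ (L `&` (U a `&` U b)) !=set0].
apply: (@sub_countable _ _ A (\bigcup_(a in D) M a)); last first.
  apply: bigcup_countable; last by move=> a /DA; exact: h.
  by apply: ccc_disjoint_countable tD => // a /DA; exact: UA.
apply: subset_card_le => b Ab; apply: contrapT => nb.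
have nDb : ~ D b.
  move=> Db; apply: nb; exists b => //; split => //; rewrite setIid.
  exact: (UA b Ab).2.
have meetP a : D a -> (L `&` U a) `&` (L `&` U b) !=set0 -> False.
  move=> Da [x [[Lx Ux] [_ Ux']]]; apply: nb; exists a => //.
  by split => //; exists x.
apply: (maxD (D `|` [set b])).
- split; first by left.
  by move=> /(_ b) /=; move=> /(_ (or_intror erefl)).
- by move=> c [/DA//|->].
- move=> c d [Dc|->] [Dd|->] //.
  + exact: tD.
  + by move=> /meetP; case.
  + by rewrite setIC => /meetP; case.
Qed.

(** Recursive choice that keeps uncountably many candidates: [ccc_uncountable_meet] picks the next
    index, and its countably many bad successors are thrown away. *)
Lemma ccc_linked_sequence (T : topologicalType) (L : set T) (J : Type)
    (U : J -> set T) (bad : J -> J -> Prop) (A : set J) : ccc_set L ->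
  (forall a, A a -> open (U a) /\ (L `&` U a) !=set0) ->
  (forall a, A a -> countable (A `&` [set b | bad a b])) -> ~ countable A ->
  exists s : nat -> J, (forall n, A (s n)) /\
    (forall m n, (m < n)%N -> ~ bad (s m) (s n)) /\
    (forall N, exists2 y, L y & forall k, (k < N)%N -> U (s k) y).
Proof.
move=> cccL UA badA ncA.
(* A state pairs the intersection of the open sets chosen so far with an uncountable reservoir of
   indices whose sets meet it inside [L]. *)
pose inv (p : set T * set J) := [/\ open p.1, p.2 `<=` A, ~ countable p.2 &
  forall a, p.2 a -> (L `&` (p.1 `&` U a)) !=set0].
pose next (p : set T * set J) a : set T * set J := (p.1 `&` U a,
  [set b | p.2 b /\ (L `&` ((p.1 `&` U a) `&` U b)) !=set0] `\`
  (A `&` [set b | bad a b])).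
have /choice[f fP] p : exists a, inv p -> p.2 a /\ inv (next p a).
  have [ip|?] := pselect (inv p); last first.
    have [[a _]|nA] := pselect (A !=set0); first by exists a.
    case: ncA; rewrite (_ : A = set0)//.
    by apply/seteqP; split => // a Aa; apply: nA; exists a.
  case: ip => op pA ncp pU.
  have [|a pa ncU] := @ccc_uncountable_meet T L J (fun a => p.1 `&` U a) p.2 cccL _ ncp.
    by move=> a pa; split; [apply: openI => //; exact: (UA a (pA a pa)).1|exact: pU].
  exists a => _; split => //; split => /=.
  - by apply: openI => //; exact: (UA a (pA a pa)).1.
  - by move=> b [[/pA]].
  - apply: uncountable_setD (badA a (pA a pa)); move: ncU; apply: contra_not.
    apply: sub_countable; apply: subset_card_le => b /= [pb [x [Lx]]].
    by move=> [[px pax] [_ pbx]]; split => //; exists x.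
  - by move=> b [[]].
pose st n := iter n (fun p => next p (f p)) (setT, A).
have inv_st n : inv (st n).
  elim: n => [|n /fP[]//]; split => //=; first exact: openT.
  by move=> a /UA[]; rewrite setTI.
have stS n : st n.+1 = next (st n) (f (st n)) by [].
exists (fun n => f (st n)); split; [|split].
- by move=> n; have [_ pA _ _] := inv_st n; exact/pA/(fP _ (inv_st n)).1.
- have sub m n : (m <= n)%N -> (st n).2 `<=` (st m).2.
    elim: n => [|n IH]; first by rewrite leqn0 => /eqP ->.
    rewrite leq_eqVlt => /predU1P[->//|/IH]; apply: subset_trans.
    by rewrite stS => b [[]].
  move=> m n mn bad_mn; have := (fP _ (inv_st n)).1.
  move=> /(sub _ _ mn); rewrite stS => -[_]; apply; split => //.
  by have [_ pA _ _] := inv_st n; exact/pA/(fP _ (inv_st n)).1.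
- move=> N; have stU k n x : (k < n)%N -> (st n).1 x -> U (f (st k)) x.
    elim: n => // n IH; rewrite ltnS leq_eqVlt stS => /predU1P[-> []//|kn].
    by case=> stx _; exact: IH.
  have [_ _ _ /(_ _ (fP _ (inv_st N)).1)[y [Ly [sty _]]]] := inv_st N.
  by exists y => // k kN; exact: stU sty.
Qed.

(** * Copies of l1 from independent sequences *)

(** Rosenthal's argument: the upper bound is the triangle inequality, and the lower one comes from
    testing partial sums at two points with opposite patterns. *)
Lemma contains_l1_of_patterns (R : realType) (X : completeNormedModType R)
    (P : Type) (Phi : P -> X -> R) (x : nat -> X) (M C r d : R) :
  0 < d -> 0 < M -> 0 < C ->
  (forall n, `|x n| <= M) -> (forall p u, `|Phi p u| <= C * `|u|) ->
  (forall p u v, Phi p (u + v) = Phi p u + Phi p v) ->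
  (forall p a u, Phi p (a *: u) = a * Phi p u) ->
  (forall N (e : nat -> bool), exists p, forall k, (k < N)%N ->
     if e k then r + d <= Phi p (x k) else Phi p (x k) <= r) ->
  contains_l1 X.
Proof.
move=> d0 M0 C0 xM PhiC PhiD PhiZ pat.
pose S (u : nat -> R) : X^nat := series (fun k => u k *: x k).
pose A (u : nat -> R) : R^nat := series (fun k => `|u k|).
have Phi0 p : Phi p 0 = 0 by rewrite -(scale0r (0 : X)) PhiZ mul0r.
have PhiS p u N : Phi p (S u N) = \sum_(0 <= k < N) u k * Phi p (x k).
  rewrite /S /series /= (big_morph (Phi p) (PhiD p) (Phi0 p)).
  by apply: eq_bigr => k _; rewrite PhiZ.
have SM u N : `|S u N| <= M * A u N.
  rewrite /S /A /series /= mulr_sumr (le_trans (ler_norm_sum _ _ _))//.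
  by apply: ler_sum => k _; rewrite normrZ mulrC ler_wpM2r.
have cS u : l1 u -> cvgn (S u).
  move=> cu; apply: normed_cvg.
  apply: (@series_le_cvg _ _ (fun k => M * `|u k|)) => //.
  - by move=> k /=.
  - by move=> k; rewrite mulr_ge0// ltW.
  - by move=> k /=; rewrite normrZ mulrC ler_wpM2r.
  - exact: (@is_cvg_seriesZ _ _ M cu).
have AS u N : d / (2 * C) * A u N <= `|S u N|.
  (* [p] follows the signs of [u] and [q] the opposite ones, so each term of the difference
     contributes at least [d] times the absolute value of its coefficient. *)
  have [p hp] := pat N (fun k => 0 < u k).
  have [q hq] := pat N (fun k => ~~ (0 < u k)).
  have dA : d * A u N <= Phi p (S u N) - Phi q (S u N).
    rewrite !PhiS -sumrB /A /series /= mulr_sumr !big_mkord.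
    apply: ler_sum => -[k kN] _ /=; have := hp k kN; have := hq k kN.
    rewrite -mulrBr mulrC; case: ltP => /= u0 h1 h2.
      by rewrite gtr0_norm// ler_pM2l//; lra.
    by rewrite ler0_norm// mulNr -mulrN ler_wnM2l//; lra.
  have := PhiC p (S u N); have := PhiC q (S u N); rewrite !ler_norml.
  move=> /andP[h1 h2] /andP[h3 h4].
  rewrite mulrAC ler_pdivrMr ?mulr_gt0//; lra.
exists (fun u => limn (S u)), (d / (2 * C)), M.
split; [by rewrite divr_gt0// mulr_gt0|split => //; split].
  move=> a u v lu lv.
  have cu := cS u lu; have cv := cS v lv.
  have -> : S (fun k => a * u k + v k) = a *: S u + S v.
    apply/funext => n; rewrite -[RHS]/(a *: S u n + S v n) /S /series /=.
    rewrite scaler_sumr -big_split /=.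
    by apply: eq_bigr => k _; rewrite scalerDl scalerA.
  apply/cvg_lim => //; apply: cvgD => //; exact: cvgZl_tmp.
move=> u lu; have cn : (fun n => `|S u n|) @ \oo --> `|limn (S u)|.
  by apply: cvg_norm; exact: cS.
have cA (c : R) : (fun n => c * A u n) @ \oo --> c * l1norm u.
  exact: cvgMl_tmp.
apply/andP; split.
  by apply: ler_cvg_to (cA _) cn _; apply: nearW => n /=; exact: AS.
by apply: ler_cvg_to cn (cA _) _; apply: nearW => n /=; exact: SM.
Qed.

(** * Expansions with overlapping digits *)

Section overlapping_digits.
Context (R : realType) (l W : R).

Definition width (n : nat) : R := W * (2 / 3) ^+ n.

(** The children of an interval are its left and its right two thirds, which overlap in the middle
    third. *)
Fixpoint left_end (z : nat -> bool) (n : nat) : R :=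
  if n is m.+1 then left_end z m + (if z m then width m / 3 else 0) else l.

Definition inside (z : nat -> bool) (n : nat) (x : R) : Prop :=
  left_end z n < x < left_end z n + width n.

Definition codes (z : nat -> bool) (x : R) : Prop := forall n, inside z n x.

(** The left ends do not decrease and the widths tend to 0, so this is the only point common to all
    the closed intervals; it makes sense also for digits that place no point strictly inside. *)
Definition value (z : nat -> bool) : R := sup (range (left_end z)).

Hypothesis W_gt0 : 0 < W.

Lemma width_gt0 n : 0 < width n.
Proof. by rewrite /width mulr_gt0// exprn_gt0// divr_gt0. Qed.

Lemma widthS n : width n.+1 = width n * 2 / 3.
Proof. by rewrite /width exprSr !mulrA. Qed.

Lemma left_endS_itv z n :
  left_end z n <= left_end z n.+1 /\
  left_end z n.+1 + width n.+1 <= left_end z n + width n.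
Proof.
have := width_gt0 n; rewrite /= widthS; case: (z n); lra.
Qed.

Lemma left_end_itv z m n : (m <= n)%N ->
  left_end z m <= left_end z n /\
  left_end z n + width n <= left_end z m + width m.
Proof.
elim: n => [|n IH]; first by rewrite leqn0 => /eqP ->.
rewrite leq_eqVlt => /predU1P[->//|/IH[h1 h2]].
have [h3 h4] := left_endS_itv z n.
by split; [exact: le_trans h3|exact: le_trans h2].
Qed.

Lemma left_end_lt z m n : left_end z m < left_end z n + width n.
Proof.
have := width_gt0 n; have := width_gt0 m.
by have [/(left_end_itv z)|/ltnW/(left_end_itv z)] := leqP m n; lra.
Qed.

Lemma inside_le z m n x : (m <= n)%N -> inside z n x -> inside z m x.
Proof. by move=> /(left_end_itv z) + /andP[]; rewrite /inside; lra. Qed.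

Lemma value_itv z n : left_end z n <= value z <= left_end z n + width n.
Proof.
apply/andP; split.
  apply: ub_le_sup; last by exists n.
  by exists (left_end z 0 + width 0) => _ [m _ <-]; exact/ltW/left_end_lt.
apply: ge_sup; first by exists (left_end z 0); exists 0%N.
by move=> _ [m _ <-]; exact/ltW/left_end_lt.
Qed.

Lemma width_cvg0 : width @ \oo --> 0.
Proof.
rewrite -[0](mulr0 W); apply: cvgMl_tmp.
apply: cvg_expr; rewrite ger0_norm; lra.
Qed.

Lemma width_small (e : R) : 0 < e -> exists n, width n < e.
Proof.
move=> e0; have /cvgrPdist_lt/(_ e e0)[n _ /(_ n (leqnn n))] := width_cvg0.
by rewrite sub0r normrN gtr0_norm ?width_gt0//; exists n.
Qed.

Lemma codes_value z x : codes z x -> value z = x.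
Proof.
move=> zx; apply/eqP; rewrite -subr_eq0 -normr_eq0; apply/eqP/le_anti.
rewrite normr_ge0 andbT; apply/ler_addgt0Pl => e /width_small[n we].
rewrite addr0; have := zx n; have := value_itv z n; rewrite /inside ler_norml.
move=> /andP[? ?] /andP[? ?]; apply/andP; split; lra.
Qed.

Lemma eq_left_end z z' n :
  (forall k, (k < n)%N -> z k = z' k) -> left_end z n = left_end z' n.
Proof.
elim: n => //= n IH h; rewrite IH => [|k kn]; first by rewrite h.
by rewrite h// ltnS ltnW.
Qed.

Lemma value_dist z z' n : (forall k, (k < n)%N -> z k = z' k) ->
  `|value z - value z'| <= width n.
Proof.
move=> /eq_left_end e; have := value_itv z n; have := value_itv z' n.
rewrite e ler_norml => /andP[? ?] /andP[? ?]; apply/andP; split; lra.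
Qed.

(* Since the two halves overlap, a number strictly inside an interval is
   strictly inside one of the two halves. *)
Lemma codes_extend z n x : inside z n x ->
  exists z', (forall k, (k < n)%N -> z' k = z k) /\ codes z' x.
Proof.
(* The first [n] digits are kept; later ones compare [x] with the midpoint, which lies strictly
   inside both halves. [E] computes the left ends alongside, since each new digit depends on the
   current one. *)
move=> zx; pose d m e := if (m < n)%N then z m else e + width m / 2 < x.
pose E := fix E m : R :=
  if m is k.+1 then E k + (if d k (E k) then width k / 3 else 0) else l.
pose z' m := d m (E m).
have z'E m : left_end z' m = E m by elim: m => //= m ->.
have z'z k : (k < n)%N -> z' k = z k by rewrite /z' /d => ->.
exists z'; split => // m.
have [mn|/ltnW/subnK <-] := leqP m n.
  apply: (inside_le mn); by rewrite /inside (@eq_left_end z' z n).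
elim: (m - n)%N => [|k]; first by rewrite add0n /inside (@eq_left_end z' z n).
rewrite addSn; set j := (k + n)%N => /andP[h1 h2]; rewrite /inside /=.
have zj : z' j = (left_end z' j + width j / 2 < x).
  by rewrite {1}/z' /d ltnNge leq_addl z'E.
have := width_gt0 j; rewrite -/(width j.+1) widthS zj; move=> w0.
by case: (ltP (left_end z' j + width j / 2) x) => /= xj; apply/andP; split; lra.
Qed.

End overlapping_digits.

(** * Closed subspaces of Cantor cubes *)

Lemma ptws_cvg (I : Type) (V : topologicalType) (F : set_system {ptws I -> V})
    (f : {ptws I -> V}) : Filter F ->
  (forall i, (fun g : {ptws I -> V} => g i) @ F --> f i) -> F --> f.
Proof.
move=> FF cF; apply/cvg_sup => i A [B [[C oC <-] /= Cfi BA]].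
by apply: filterS BA _; apply: cF; exact: open_nbhs_nbhs.
Qed.

Lemma ptws_eval_continuous (I : choiceType) (V : topologicalType) (i : I) :
  continuous (fun f : {ptws I -> V} => f i).
Proof. exact: (@proj_continuous I (fun=> V) i). Qed.

(** The filter generated by the cylinders at [z] converges to [z] in each coordinate, hence in the
    product topology. *)
Lemma nbhs_cylinder (J : choiceType) (z : {ptws J -> bool}) (A : set {ptws J -> bool}) :
  nbhs z A -> exists E : seq J, forall z', {in E, z =1 z'} -> A z'.
Proof.
pose F := filter_from [set: seq J] (fun E => [set z' : {ptws J -> bool} | {in E, z =1 z'}]).
have FF : Filter F.
  apply: filter_from_filter; first by exists [::].
  move=> E E' _ _; exists (E ++ E') => // z' zz'; split => p pE; apply: zz';
    by rewrite mem_cat pE ?orbT.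
have : F --> z.
  apply: ptws_cvg => p B /nbhs_singleton Bzp; exists [:: p] => // z' zz' /=.
  by rewrite -(zz' p)// inE.
by move=> /(_ A) h /h [E _ EA]; exists E.
Qed.

Lemma cylinder_clopen (J : choiceType) (z : {ptws J -> bool}) (E : seq J) :
  clopen [set z' : {ptws J -> bool} | {in E, z =1 z'}].
Proof.
elim: E => [|p E IH].
  by rewrite (_ : mkset _ = setT); [exact: clopenT|apply/seteqP; split].
rewrite (_ : mkset _ = (fun f : {ptws J -> bool} => f p) @^-1` [set z p] `&`
    [set z' | {in E, z =1 z'}]).
  apply: clopenI => //; apply: preimage_clopen; last exact: ptws_eval_continuous.
  by split; [exact: discrete_open|exact: discrete_closed].
apply/seteqP; split => z' /=.
  move=> h; split; first by rewrite h// inE eqxx.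
  by move=> q qE; rewrite h// inE qE orbT.
by move=> [h1 h2] q; rewrite inE => /predU1P[->//|/h2].
Qed.

Section sub_cantor.
Context (J : choiceType) (K : set {ptws J -> bool}).

Lemma nbhs_sub_cylinder (z : K) (A : set K) :
  nbhs z A -> exists E : seq J, forall z' : K, {in E, \val z =1 \val z'} -> A z'.
Proof.
move=> [B [[C oC <-] /= Cz BA]].
have [E EC] := nbhs_cylinder (open_nbhs_nbhs (conj oC Cz)).
by exists E => z' /EC Cz'; exact: BA.
Qed.

Lemma sub_val_continuous : continuous (\val : K -> {ptws J -> bool}).
Proof. exact: (@initial_continuous K {ptws J -> bool} \val). Qed.

Lemma sub_cylinder_clopen (z : K) (E : seq J) :
  clopen [set z' : K | {in E, \val z =1 \val z'}].
Proof.
exact: (preimage_clopen (cylinder_clopen (\val z) E) sub_val_continuous).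
Qed.

Lemma sub_zero_dim : zero_dim K.
Proof.
move=> U z oU Uz; have [E EU] := nbhs_sub_cylinder (open_nbhs_nbhs (conj oU Uz)).
exists [set z' : K | {in E, \val z =1 \val z'}].
by split; [exact: sub_cylinder_clopen|split].
Qed.

Lemma sub_compact_space : closed K -> compact_space K.
Proof.
move=> cK; split.
  move=> p q clpq; apply: val_inj.
  have hZ : hausdorff_space {ptws J -> bool}.
    by apply: (@hausdorff_product J (fun=> bool)) => _; exact: discrete_hausdorff.
  apply: hZ => A B /sub_val_continuous nA /sub_val_continuous nB.
  by have [x [Ax Bx]] := clpq _ _ nA nB; exists (\val x).
move=> F FF _; have cKK : compact K.
  apply: (@subclosed_compact _ K setT) => //.
  rewrite (_ : setT = [set f : forall j : J, bool | forall j, setT (f j)]).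
    by apply: (@tychonoff J (fun=> bool) (fun=> setT)) => _; exact: bool_compact.
  by apply/seteqP; split.
have [|p [Kp clp]] := cKK (fmap \val F) (fmap_proper_filter _ FF).
  by apply: (@filterE _ F) => z; exact: (set_mem (valP z)).
exists (exist _ p (mem_set Kp)); split => // A B FA nB.
move: nB => [_ [[C oC <-] /= Cp CB]].
have FA' : (fmap \val F) (\val @` A) by apply: (@filterS _ F _ A) => // z Az; exists z.
have [_ [[z Az <-] Cz]] := clp _ _ FA' (open_nbhs_nbhs (conj oC Cp)).
by exists z; split => //; exact: CB.
Qed.

(** Uniform continuity in terms of cylinders: compactness, used along the filter of finite lists
    ordered by inclusion, merges the local cylinders into one list. *)
Lemma sub_uniform (P : K -> K -> Prop) : compact [set: K] ->
  (forall z : K, exists2 A : set K, nbhs z A & forall z1 z2, A z1 -> A z2 -> P z1 z2) ->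
  exists E : seq J, forall z1 z2, {in E, \val z1 =1 \val z2} -> P z1 z2.
Proof.
move=> /compact_near_coveringP cK Pnear.
pose F := filter_from [set: seq J] (fun E => [set E' : seq J | {subset E <= E'}]).
have FF : Filter F.
  apply: filter_from_filter; first by exists [::].
  move=> E E' _ _; exists (E ++ E') => // E'' sE; split => p pE; apply: sE;
    by rewrite mem_cat pE ?orbT.
have [|E _ EP] := cK _ F (fun E z1 => forall z2, {in E, \val z1 =1 \val z2} -> P z1 z2) FF.
  move=> z _; have [A nA AP] := Pnear z.
  have [EA EAA] := nbhs_sub_cylinder nA.
  exists (A `&` [set z' : K | {in EA, \val z =1 \val z'}], [set E' : seq J | {subset EA <= E'}]).
    split => /=; last by exists EA.
    apply: filterI => //; apply: open_nbhs_nbhs; split => //.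
    exact: (sub_cylinder_clopen _ _).1.
  move=> [z1 E'] /= [[Az1 zz1] sE'] z2 z12; apply: AP => //.
  by apply: EAA => p pE; exact: etrans (zz1 p pE) (z12 p (sE' p pE)).
by exists E => z1 z2 z12; exact: (EP E (fun _ => id)).
Qed.

End sub_cantor.

(** * Segments in convex sets *)

(** By connectedness of the unit interval: if the two sets were disjoint, [T1] would be clopen in
    it, hence contain 1. *)
Lemma segment_cover_meet (R : realType) (T1 T2 : set R) :
  T1 0 -> T2 1 ->
  (forall t, 0 <= t <= 1 -> T1 t \/ T2 t) ->
  (forall t, T1 t -> \forall s \near t, 0 <= s <= 1 -> T1 s) ->
  (forall t, T2 t -> \forall s \near t, 0 <= s <= 1 -> T2 s) ->
  exists t, T1 t /\ T2 t.
Proof.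
move=> T10 T21 cover o1 o2; apply: contrapT => disj.
pose A : set R := `[0, 1]%classic.
(* By [TO] below, [O T] is an open set with the same trace on the interval as [T]. *)
pose O (T : set R) := interior [set s | 0 <= s <= 1 -> T s].
have AE t : A t = (0 <= t <= 1) by rewrite /A /= in_itv.
have TO (T : set R) : (forall t, T t -> \forall s \near t, 0 <= s <= 1 -> T s) ->
    forall t, A t -> (A `&` T) t <-> (A `&` O T) t.
  move=> oT t At; split => -[_ h]; split => //; first exact: oT.
  by apply: (nbhs_singleton h); rewrite -AE.
have : A `&` T1 = A.
  apply: (@segment_connected R 0 1).
  - by exists 0; split => //; rewrite AE lexx ler01.
  - exists (O T1); first exact: open_interior.
    by apply/seteqP; split => t tA; apply/(TO _ o1 t); rewrite //; case: tA.
  - exists (~` O T2); first exact/open_closedC/open_interior.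
    apply/seteqP; split => t [At Tt]; split => //.
      move=> O2; apply: disj; exists t; split => //.
      by have [] := (TO _ o2 t At).2 (conj At O2).
    have [//|T2t] := cover t (eq_ind _ id At _ (AE t)).
    by case: Tt; have [] := (TO _ o2 t At).1 (conj At T2t).
move=> /seteqP[_ /(_ 1)]; rewrite AE ler01 lexx => /(_ isT)[_ T11].
by apply: disj; exists 1.
Qed.

Lemma convex_setP (R : realType) (V : lmodType R) (L : set V) (x y : V) (t : R) :
  convex_set (L : set (convex_lmodType V)) -> L x -> L y -> 0 <= t <= 1 ->
  L (t *: x + (1 - t) *: y).
Proof.
move=> cL Lx Ly t01.
have t01' : Itv.spec (Itv.num_sem (R:=R)) (Itv.Real `[0%Z, 1%Z]) t.
  by rewrite /= /Itv.num_sem /= num_real /= in_itv /=.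
have := cL x y (Itv.mk t01') (mem_set Lx) (mem_set Ly).
by move=> /set_mem.
Qed.

Lemma convex_combination_itv (R : realType) (lo hi x y t : R) : 0 <= t <= 1 ->
  lo < x < hi -> lo < y < hi -> lo < t * x + (1 - t) * y < hi.
Proof.
move=> /andP[t0 t1] /andP[lx xh] /andP[ly yh].
have pos u v : 0 < u -> 0 < v -> 0 < t * u + (1 - t) * v.
  move=> u0 v0; move: t0; rewrite le_eqVlt => /predU1P[<-|t0].
    by rewrite mul0r add0r subr0 mul1r.
  by rewrite ltr_pwDl ?mulr_gt0// mulr_ge0 ?subr_ge0// ltW.
have := pos (x - lo) (y - lo); have := pos (hi - x) (hi - y).
rewrite !subr_gt0 => /(_ xh yh) h1 /(_ lx ly) h2; apply/andP; split; lra.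
Qed.

(** * The space of codes *)

Section coding.
Context (R : realType) (I : choiceType) (L : set {ptws I -> R}) (l W : I -> R).
Hypothesis W_gt0 : forall i, 0 < W i.
Hypothesis L_inside : forall x, L x -> forall i, l i < x i < l i + W i.

Definition digit_row (z : {ptws I * nat -> bool}) (i : I) : nat -> bool := fun n => z (i, n).

Definition coded (z : {ptws I * nat -> bool}) (x : {ptws I -> R}) : Prop :=
  L x /\ forall i, codes (l i) (W i) (digit_row z i) (x i).

Definition decode (z : {ptws I * nat -> bool}) : {ptws I -> R} :=
  fun i => value (l i) (W i) (digit_row z i).

(** The closure gives compactness while coded arrays stay dense; at limit arrays the membership in
    intervals may fail to be strict. *)
Definition code_space : set {ptws I * nat -> bool} :=
  closure [set z | exists x, coded z x].

Definition agree (F : seq I) (n : nat) (z z' : {ptws I * nat -> bool}) : Prop :=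
  forall i k, i \in F -> (k < n)%N -> z (i, k) = z' (i, k).

Lemma agree_sym F n z z' : agree F n z z' -> agree F n z' z.
Proof. by move=> h i k iF kn; rewrite h. Qed.

Lemma agree_trans F n z1 z2 z3 : agree F n z1 z2 -> agree F n z2 z3 -> agree F n z1 z3.
Proof. by move=> h h' i k iF kn; rewrite h// h'. Qed.

Lemma agree_sub F F' n n' z z' : {subset F <= F'} -> (n <= n')%N ->
  agree F' n' z z' -> agree F n z z'.
Proof. by move=> sF nn' h i k iF kn; rewrite h ?sF// (leq_trans kn). Qed.

Definition digit_pattern (D : seq I) (n : nat) (z : {ptws I * nat -> bool}) :
    {ffun 'I_(size D) * 'I_n -> bool} :=
  [ffun p => z (tnth (in_tuple D) p.1, val p.2)].

Lemma digit_pattern_agree D n z z' :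
  digit_pattern D n z = digit_pattern D n z' -> agree D n z z'.
Proof.
move=> /ffunP zz' i k iD kn; have iD' := iD; rewrite -index_mem in iD.
have := zz' (Ordinal iD, Ordinal kn); rewrite !ffunE /=.
by rewrite (tnth_nth i) /= nth_index.
Qed.

Lemma agree_finite (E : seq (I * nat)) : exists F n, forall z z',
  agree F n z z' -> {in E, z =1 z'}.
Proof.
exists (map fst E), (\max_(p <- E) p.2).+1 => z z' h [i k] ikE.
apply: h; first by apply/mapP; exists (i, k).
by rewrite ltnS; apply: (@leq_bigmax_seq _ E xpredT (fun p : I * nat => p.2) (i, k)).
Qed.

Lemma agree_inside F n z z' x i : agree F n z z' -> i \in F ->
  inside (l i) (W i) (digit_row z i) n x -> inside (l i) (W i) (digit_row z' i) n x.
Proof.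
move=> zz' iF; rewrite /inside (@eq_left_end _ (l i) (W i) (digit_row z i) (digit_row z' i))//.
by move=> k kn; exact: zz'.
Qed.

Lemma coded_decode z x : coded z x -> decode z = x.
Proof. by move=> [_ zx]; apply/funext => i; exact: codes_value. Qed.

(** Coordinates are coded independently: where [x i] lies in the interval of [y] at depth [n], the
    first [n] digits of [y] are kept; elsewhere coding starts afresh from depth 0. This is the
    openness of decoding. As [y] is arbitrary, it may be glued from several arrays. *)
Lemma coded_exists x (y : {ptws I * nat -> bool}) n : L x ->
  exists z, coded z x /\ forall F : seq I,
    (forall i, i \in F -> inside (l i) (W i) (digit_row y i) n (x i)) -> agree F n z y.
Proof.
move=> Lx; have /choice[f fP] i : exists z, codes (l i) (W i) z (x i) /\
    (inside (l i) (W i) (digit_row y i) n (x i) -> forall k, (k < n)%N -> z k = y (i, k)).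
  have [yi|nyi] := pselect (inside (l i) (W i) (digit_row y i) n (x i)).
    have [z [zy zx]] := codes_extend (W_gt0 i) yi.
    by exists z; split.
  have x0 : inside (l i) (W i) (digit_row y i) 0 (x i).
    by rewrite /inside /= /width expr0 mulr1; exact: L_inside.
  by have [z [_ zx]] := codes_extend (W_gt0 i) x0; exists z.
exists (fun p => f p.1 p.2); split.
  by split => // i; exact: (fP i).1.
by move=> F yF i k iF kn; exact: (fP i).2 (yF i iF) k kn.
Qed.

Lemma decode_continuous : continuous decode.
Proof.
move=> z; apply: ptws_cvg => i; apply/cvgrPdist_lt => e e0.
have [n wn] := width_small (W_gt0 i) e0.
have nz : nbhs z [set z' | {in [seq (i, k) | k <- iota 0 n], z =1 z'}].
  by apply: open_nbhs_nbhs; split => //; exact: (cylinder_clopen _ _).1.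
apply: filterS nz => z' zz'; apply: le_lt_trans wn; apply: value_dist => // k kn.
by apply: zz'; apply/mapP; exists k => //; rewrite mem_iota.
Qed.

Lemma decode_image : closed L -> decode @` code_space = L.
Proof.
move=> cL; apply/seteqP; split => [_ [z Kz <-]|x Lx].
  (* The arrays decoding into the closed set [L] form a closed set that contains all coded ones. *)
  have : code_space `<=` decode @^-1` L.
    have /closure_id -> : closed (decode @^-1` L).
      by apply: closed_comp => // z' _; exact: decode_continuous.
    by apply: closure_subset => z' [x zx] /=; rewrite (coded_decode zx); case: zx.
  exact.
have [z [zx _]] := coded_exists (fun=> false) 0 Lx.
by exists z; [apply: subset_closure; exists x|exact: coded_decode].
Qed.

Lemma coded_sub z x : coded z x -> exists z' : code_space, \val z' = z.
Proof.
move=> zx; have Kz : z \in code_space by apply/mem_set/subset_closure; exists x.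
by exists (exist _ z Kz).
Qed.

Lemma coded_dense (U : set code_space) (z : code_space) : open U -> U z ->
  exists z' : code_space, U z' /\ exists x, coded (\val z') x.
Proof.
move=> [V oV <-] Vz.
have := set_valP z => /(_ V (open_nbhs_nbhs (conj oV Vz))) [z' [[x zx] Vz']].
have [z'' e] := coded_sub zx.
by exists z''; split; [rewrite /= /set_val /= e|exists x; rewrite e].
Qed.

Lemma inside_near (F : seq I) n z (y : {ptws I -> R}) :
  (forall i, i \in F -> inside (l i) (W i) (digit_row z i) n (y i)) ->
  \forall y' \near y, forall i, i \in F -> inside (l i) (W i) (digit_row z i) n (y' i).
Proof.
have FFy : Filter (nbhs y) by exact: (@nbhs_filter {ptws I -> R} y).
elim: F => [|i F IH] h; first by apply: filterE => y' i; rewrite in_nil.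
have oi : open [set t : R | inside (l i) (W i) (digit_row z i) n t].
  rewrite (_ : mkset _ = `]left_end (l i) (W i) (digit_row z i) n,
    left_end (l i) (W i) (digit_row z i) n + width (W i) n[%classic).
    exact: itv_open.
  by apply/seteqP; split => t; rewrite /= in_itv.
have ni : nbhs (y i) [set t : R | inside (l i) (W i) (digit_row z i) n t].
  by apply: open_nbhs_nbhs; split => //; apply: h; rewrite inE eqxx.
have nF := IH (fun j jF => h j (@mem_behead _ (i :: F) j jF)).
have nyi := @ptws_eval_continuous I R i y _ ni.
apply: (@filterS _ (nbhs y) FFy _ _ _ (@filterI _ (nbhs y) FFy _ _ nyi nF)) => y' [/= y'i y'F] j.
by rewrite inE => /predU1P[->|/y'F].
Qed.

End coding.

(** * Finite dependence and split fibres *)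

Section code_space_dependence.
Context (R : realType) (I : choiceType) (L : set {ptws I -> R}) (l W : I -> R).
Hypothesis W_gt0 : forall i, 0 < W i.
Hypothesis L_inside : forall x, L x -> forall i, l i < x i < l i + W i.
Hypothesis convL : convex_set L.

Let K : set {ptws I * nat -> bool} := code_space L l W.

Lemma code_space_compact : compact_space K.
Proof. exact/sub_compact_space/closed_closure. Qed.

(** Membership in [b] is locally constant, so [sub_uniform] applies; one implication suffices
    because [agree] is symmetric. *)
Lemma clopen_dependence (b : set K) : clopen b -> exists F n, forall z z' : K,
  agree F n (\val z) (\val z') -> b z -> b z'.
Proof.
move=> [ob cb]; have [|E EP] := @sub_uniform _ K (fun z z' => b z -> b z') code_space_compact.2.
  move=> z; have [bz|nbz] := pselect (b z).
    by exists b => //; exact: open_nbhs_nbhs.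
  exists (~` b) => //; apply: open_nbhs_nbhs; split => //; exact: closed_openC.
have [F [n FE]] := agree_finite E; exists F, n => z z' /FE; exact: EP.
Qed.

Lemma continuous_dependence (T : eqType) (g : K -> T -> R) (s : seq T) (e : R) :
  0 < e -> (forall x, continuous (g^~ x)) -> exists F n, forall z z' : K,
  agree F n (\val z) (\val z') -> forall x, x \in s -> `|g z x - g z' x| < e.
Proof.
move=> e0 cg; elim: s => [|x s [F [n Fs]]]; first by exists [::], 0%N.
have [|E EP] := @sub_uniform _ K (fun z z' => `|g z x - g z' x| < e) code_space_compact.2.
  move=> z; exists [set z' | `|g z x - g z' x| < e / 2].
    by have /cvgrPdist_lt := cg x z; apply; rewrite divr_gt0.
  move=> z1 z2 /= h1 h2; rewrite -(subrKA (g z x)) (le_lt_trans (ler_normD _ _))//.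
  by rewrite [e]splitr ltrD// distrC.
have [F' [n' FE']] := agree_finite E.
exists (F ++ F'), (maxn n n') => z z' zz' y; rewrite inE => /predU1P[->|].
  apply/EP/FE'; apply: agree_sub zz'; last exact: leq_maxr.
  by move=> i iF; rewrite mem_cat iF orbT.
apply: Fs; apply: agree_sub zz'; last exact: leq_maxl.
by move=> i iF; rewrite mem_cat iF.
Qed.

(** For each pair of points separated by [b], one [x] works throughout a neighbourhood; compactness
    of the square of [K] leaves finitely many such [x]. *)
Lemma finite_separation (T : eqType) (g : K -> T -> R) (b : set K) : clopen b ->
  (forall x, continuous (g^~ x)) ->
  (forall z z', b z -> ~ b z' -> exists x, 1 < `|g z x - g z' x|) ->
  exists s : seq T, forall z z', b z -> ~ b z' ->
    exists2 x, x \in s & 1 < `|g z x - g z' x|.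
Proof.
move=> [ob cb] cg sep.
have /compact_near_coveringP cKK := compact_setX code_space_compact.2 code_space_compact.2.
pose F := filter_from [set: seq T] (fun s => [set s' : seq T | {subset s <= s'}]).
have FF : Filter F.
  apply: filter_from_filter; first by exists [::].
  move=> s s' _ _; exists (s ++ s') => // s'' ss; split => p ps; apply: ss;
    by rewrite mem_cat ps ?orbT.
have [|s _ sP] := cKK _ F (fun s p => b p.1 -> ~ b p.2 ->
  exists2 x, x \in s & 1 < `|g p.1 x - g p.2 x|) FF; last first.
  by exists s => z z'; exact: (sP s (fun _ => id) (z, z')).
move=> [z z'] _; have [bz|nbz] := pselect (b z); last first.
  exists ((~` b `*` setT), setT) => /=; last by move=> [[z1 z2] s] /= [[]].
  split; last exact: filterT.
  exists (~` b, setT) => //; split => /=; last exact: filterT.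
  by apply: open_nbhs_nbhs; split => //; exact: closed_openC.
have [bz'|nbz'] := pselect (b z').
  exists ((setT `*` b), setT) => /=; last by move=> [[z1 z2] s] /= [[_ ?]].
  split; last exact: filterT.
  exists (setT, b) => //; split => /=; first exact: filterT.
  exact: open_nbhs_nbhs.
have [x gx] := sep _ _ bz nbz'.
(* Half the excess over 1, so that moving both points costs less than the whole excess. *)
pose e := (`|g z x - g z' x| - 1) / 2.
have e0 : 0 < e by rewrite /e divr_gt0// subr_gt0.
pose V y := [set y' | `|g y x - g y' x| < e].
have nV y : nbhs y (V y) by have /cvgrPdist_lt := cg x y; apply.
exists ((V z `*` V z'), [set s : seq T | {subset [:: x] <= s}]) => /=.
  by split; [exists (V z, V z')|exists [:: x]].
move=> [[z1 z2] s] /= [[h1 h2] xs] _ _; exists x; first by apply: xs; rewrite inE.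
move: h1 h2; rewrite /V /= => h1 h2.
have : `|g z x - g z' x| <= `|g z x - g z1 x| + `|g z1 x - g z2 x| + `|g z' x - g z2 x|.
  rewrite [X in _ <= _ + X]distrC.
  have -> : g z x - g z' x = (g z x - g z1 x) + (g z1 x - g z2 x) + (g z2 x - g z' x) by ring.
  by rewrite (le_trans (ler_normD _ _))// lerD2r ler_normD.
rewrite /e in h1 h2; lra.
Qed.

(* The points of [L] lying in the intervals prescribed by [n] digits on [D] form
   a convex set, covered by the relatively open images of [b] and of its
   complement; connectedness makes these images meet. *)
Lemma clopen_split_fiber (b : set K) (D F : seq I) (n : nat) (z1 z2 : K) x1 x2 :
  {subset D <= F} ->
  (forall z z' : K, agree F n (\val z) (\val z') -> b z <-> b z') ->
  coded L l W (\val z1) x1 -> coded L l W (\val z2) x2 ->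
  agree D n (\val z1) (\val z2) -> b z1 -> ~ b z2 ->
  exists z z' x, [/\ coded L l W (\val z) x, coded L l W (\val z') x,
    agree D n (\val z) (\val z') & b z /\ ~ b z'].
Proof.
move=> DF bF c1 c2 z12 bz1 nbz2.
pose seg (t : R) : {ptws I -> R} := (t *: x2 + (1 - t) *: x1)%R.
have segL t : 0 <= t <= 1 -> L (seg t).
  by apply: convex_setP => //; [exact: c2.1|exact: c1.1].
have segE t i : seg t i = t * x2 i + (1 - t) * x1 i by [].
have seg_in t i : 0 <= t <= 1 -> i \in D ->
    inside (l i) (W i) (digit_row (\val z1) i) n (seg t i).
  move=> /andP[t0 t1] iD; have := agree_inside (agree_sym z12) iD (c2.2 i n).
  move=> h; rewrite /inside segE; apply: convex_combination_itv => //.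
    by rewrite t0.
  exact: c1.2.
(* Parameters whose point on the segment has a code in [c] with the prescribed digits on [D]; a
   parameter common to [b] and its complement gives the split fibre. *)
pose T (c : set K) := [set t : R | 0 <= t <= 1 /\ exists z : K,
  [/\ coded L l W (\val z) (seg t), agree D n (\val z) (\val z1) & c z]].
have lift t (y : K) : 0 <= t <= 1 -> exists z : K, coded L l W (\val z) (seg t) /\
    forall G, (forall i, i \in G -> inside (l i) (W i) (digit_row (\val y) i) n (seg t i)) ->
    agree G n (\val z) (\val y).
  move=> /segL Lt; have [z [zt zy]] := coded_exists W_gt0 L_inside (\val y) n Lt.
  by have [z' e] := coded_sub zt; exists z'; rewrite e.
(* A nearby point of the segment stays inside the same intervals on [F], so it has a code agreeing
   there with [z], and these digits decide membership in [c]. *)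
have T_open (c : set K) : (forall z z' : K, agree F n (\val z) (\val z') -> c z -> c z') ->
    forall t, T c t -> \forall s \near t, 0 <= s <= 1 -> T c s.
  move=> cF t [t01 [z [zt zz1 cz]]].
  have FFt : Filter (nbhs t) by exact: (@nbhs_filter R t).
  have cseg : seg @ t --> seg t.
    have FFs : Filter (seg @ t) by exact: (@fmap_filter R {ptws I -> R} seg (nbhs t) FFt).
    apply: (@ptws_cvg I R _ (seg t) FFs) => i.
    change ((fun s : R => s * x2 i + (1 - s) * x1 i) @ t --> t * x2 i + (1 - t) * x1 i).
    apply: cvgD; apply: cvgMr_tmp; first exact: cvg_id.
    by apply: cvgB; [exact: cvg_cst|exact: cvg_id].
  have := inside_near (F := F) (fun i _ => zt.2 i n).
  move=> /cseg nt; apply: (@filterS _ (nbhs t) FFt _ _ _ nt) => s zs s01; split => //.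
  have [z' [z's z'z]] := lift s z s01; exists z'.
  have z'zF := z'z F zs; split => //.
    exact: agree_trans (agree_sub DF (leqnn n) z'zF) zz1.
  exact: cF (agree_sym z'zF) cz.
have seg0 : seg 0 = x1 by apply/funext => i; rewrite segE mul0r add0r subr0 mul1r.
have seg1 : seg 1 = x2 by apply/funext => i; rewrite segE mul1r subrr mul0r addr0.
have [|||||t [[t01 [z [zt zz1 bz]]] [_ [z' [z't z'z1 nbz']]]]] :=
    @segment_cover_meet R (T b) (T (~` b)).
- by split; [rewrite lexx ler01|exists z1; split; rewrite ?seg0].
- split; [by rewrite lexx ler01|exists z2; split; rewrite ?seg1//].
  exact: agree_sym.
- move=> t t01; have [z [zt zy]] := lift t z1 t01.
  have zz1 := zy D (fun i => @seg_in t i t01).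
  have [bz|nbz] := pselect (b z); [left|right]; by split => //; exists z.
- by apply: T_open => z z' /bF[].
- by apply: T_open => z z' /bF[_] h nbz /h.
exists z, z', (seg t); split => //; exact: agree_trans (agree_sym z'z1).
Qed.

End code_space_dependence.

(** * Independent sequences of clopen sets *)

Section uncountable_clopen_families.
Context (R : realType) (I : choiceType) (L : set {ptws I -> R}) (l W : I -> R).
Hypothesis W_gt0 : forall i, 0 < W i.
Hypothesis L_inside : forall x, L x -> forall i, l i < x i < l i + W i.
Hypothesis convL : convex_set L.
Hypothesis cccL : ccc_set L.

Let K : set {ptws I * nat -> bool} := code_space L l W.
Let coded (z : K) x := coded L l W (\val z) x.

(** The bound is a natural number so that a pigeonhole over countably many values can make it
    uniform. *)
Lemma norm_bound_seq (V : normedModType R) (s : seq V) :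
  exists M : nat, forall x, x \in s -> `|x| <= M%:R.
Proof.
elim: s => [|x s [M sM]]; first by exists 0%N.
exists (maxn M (Num.truncn `|x|).+1) => y; rewrite inE => /predU1P[->|/sM yM].
  by rewrite (le_trans (ltW (truncnS_gt _)))// ler_nat leq_maxr.
by rewrite (le_trans yM)// ler_nat leq_maxl.
Qed.

(* A clopen set determined by [n] digits on [D] is given by a set of digit
   patterns, of which there are finitely many. *)
Lemma determined_countable (A : set (set K)) (D : seq I) (n : nat) :
  A `<=` clopen ->
  (forall b, A b -> forall z1 z2 x1 x2, coded z1 x1 -> coded z2 x2 ->
     agree D n (\val z1) (\val z2) -> b z1 -> b z2) ->
  countable A.
Proof.
move=> Acl Adet.
pose f (b : set K) : {set {ffun 'I_(size D) * 'I_n -> bool}} :=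
  [set p | `[< exists z, [/\ b z, exists x, coded z x & digit_pattern D n (\val z) = p] >]]%SET.
have f_sub b c : A b -> A c -> f b = f c -> b `<=` c.
  move=> Ab Ac fbc z bz; apply: contrapT => ncz.
  (* The difference is open, so it contains a coded array, to which [Adet] applies. *)
  have obc : open (b `&` ~` c).
    by apply: openI; [exact: (Acl _ Ab).1|exact/closed_openC/(Acl _ Ac).2].
  have [z' [[bz' ncz'] [x' c']]] := coded_dense obc (conj bz ncz).
  have : digit_pattern D n (\val z') \in f c.
    by rewrite -fbc inE; apply/asboolP; exists z'; split => //; exists x'.
  rewrite inE => /asboolP[z'' [cz'' [x'' c''] /digit_pattern_agree zz]].
  exact: ncz' (Adet c Ac z'' z' x'' x' c'' c' zz cz'').
rewrite -(eq_countable (@inj_card_eq _ _ A f _))// => b c /set_mem Ab /set_mem Ac fbc.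
by apply/seteqP; split; exact: f_sub.
Qed.

(** Each of the finitely many indices of [F a] outside [D] lies in only countably many supports;
    [None] accounts for [a] itself. *)
Lemma bad_countable (A : set (set K)) (F : set K -> seq I) (D : seq I) (a : set K) :
  (forall i, i \notin D -> countable (A `&` [set b | i \in F b])) ->
  countable (A `&` [set b | a = b \/ exists i, [/\ i \notin D, i \in F a & i \in F b]]).
Proof.
move=> cA.
apply: (@sub_countable _ _ _ (\bigcup_(o in [set` None :: map some (F a)])
    (if o is Some i then if i \in D then set0 else A `&` [set b | i \in F b] else [set a]))).
  apply: subset_card_le => b [Ab [<-|[i [iD ia ib]]]]; first by exists None.
  exists (Some i); last by rewrite /= (negbTE iD).
  by rewrite /= inE; apply/orP; right; apply/mapP; exists i.
apply: bigcup_countable; first exact: finite_set_countable.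
by move=> [i|] _ //; case: ifPn => // /cA.
Qed.

Lemma uncountable_clopens_contain_l1 (X : completeNormedModType R)
    (Phi : K -> X -> R) (C : R) (B : set (set K)) :
  0 < C -> (forall z u, `|Phi z u| <= C * `|u|) ->
  (forall z u v, Phi z (u + v) = Phi z u + Phi z v) ->
  (forall z a u, Phi z (a *: u) = a * Phi z u) ->
  (forall u, continuous (Phi^~ u)) -> B `<=` clopen ->
  (forall b z z', B b -> b z -> ~ b z' -> exists u, Phi z u <> Phi z' u) ->
  ~ countable B -> contains_l1 X.
Proof.
move=> C0 PhiC PhiD PhiZ cPhi Bcl sepB ncB.
(* The data attached to [b] are a support, a depth, a finite list of separating vectors and a bound
   for their norms. *)
have /choice[d dP] (b : set K) : exists d : seq I * nat * seq X * nat, B b ->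
    [/\ forall z z' : K, agree d.1.1.1 d.1.1.2 (\val z) (\val z') -> b z <-> b z',
        forall z z' : K, agree d.1.1.1 d.1.1.2 (\val z) (\val z') ->
          forall u, u \in d.1.2 -> `|Phi z u - Phi z' u| < 1 / 4,
        forall z z', b z -> ~ b z' ->
          exists2 u, u \in d.1.2 & 1 < `|Phi z u - Phi z' u| &
        forall u, u \in d.1.2 -> `|u| <= d.2%:R].
  have [Bb|?] := pselect (B b); last by exists ([::], 0%N, [::], 0%N).
  have [s sP] : exists s : seq X, forall z z', b z -> ~ b z' ->
      exists2 x, x \in s & 1 < `|Phi z x - Phi z' x|.
    apply: finite_separation => //; first exact: Bcl.
    move=> z z' bz nbz'; have [u /eqP] := sepB b z z' Bb bz nbz'.
    rewrite -subr_eq0 -normr_gt0 => u0.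
    (* Rescaling makes the difference equal to 2 in absolute value, hence greater than 1. *)
    exists ((2 / `|Phi z u - Phi z' u|) *: u); rewrite !PhiZ -mulrBr normrM.
    by rewrite ger0_norm ?divr_ge0// divfK ?gt_eqF// ltr1n.
  have [F1 [n1 F1P]] := clopen_dependence (Bcl b Bb).
  have e0 : (0 : R) < 1 / 4 by lra.
  have [F2 [n2 F2P]] := @continuous_dependence R I L l W X Phi s (1 / 4) e0 cPhi.
  have [M sM] := norm_bound_seq s.
  exists (F1 ++ F2, maxn n1 n2, s, M) => _ /=; split => //.
    have a1 z z' : agree (F1 ++ F2) (maxn n1 n2) (\val z) (\val z') ->
        agree F1 n1 (\val z) (\val z').
      by apply: agree_sub; [move=> i iF; rewrite mem_cat iF|exact: leq_maxl].
    by move=> z z' zz'; split; apply: F1P; apply: a1; last exact: agree_sym.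
  move=> z z' zz'; apply: F2P; apply: agree_sub zz'; last exact: leq_maxr.
  by move=> i iF; rewrite mem_cat iF orbT.
pose F0 b := (d b).1.1.1.
(* Uncountably many [b] share the depth, the norm bound and the size of the support. *)
have [[[n M] m] ncB1] := uncountable_pigeonhole
  (fun b => ((d b).1.1.2, (d b).2, size (F0 b))) ncB.
have [|D [B2 [B21 [ncB2 B2D]]]] := @delta_system _ _ F0 m _ _ ncB1.
  by move=> b [_ [_ _ <-]].
have B2B b : B2 b -> B b by move=> /B21[].
have {dP} dP b : B2 b ->
  [/\ forall z z' : K, agree (D ++ F0 b) n (\val z) (\val z') -> b z <-> b z',
      forall z z' : K, agree (D ++ F0 b) n (\val z) (\val z') ->
        forall u, u \in (d b).1.2 -> `|Phi z u - Phi z' u| < 1 / 4,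
      forall z z', b z -> ~ b z' ->
        exists2 u, u \in (d b).1.2 & 1 < `|Phi z u - Phi z' u| &
      forall u, u \in (d b).1.2 -> `|u| <= M%:R].
  move=> /B21[Bb [nE ME _]]; have [] := dP b Bb; rewrite nE ME => h1 h2 h3 h4.
  have sub z z' : agree (D ++ F0 b) n (\val z) (\val z') -> agree (F0 b) n (\val z) (\val z').
    by apply: agree_sub => // i iF; rewrite mem_cat iF orbT.
  by split => // z z' /sub; [exact: h1|exact: h2].
(* Only countably many sets are determined by the digits on [D], and they are discarded; each
   remaining one splits a fibre between codes with the same first [n] digits on [D]. *)
pose det (b : set K) := forall z1 z2 x1 x2, coded z1 x1 -> coded z2 x2 ->
  agree D n (\val z1) (\val z2) -> b z1 -> b z2.
have ncB3 : ~ countable (B2 `\` (B2 `&` det)).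
  apply: uncountable_setD ncB2 _; apply: (@determined_countable _ D n).
    by move=> b [/B2B/Bcl].
  by move=> b [].
set B3 := B2 `\` _ in ncB3.
(* The entries are two codes of one point, a vector and that point; the codes are ordered so that
   the second gives the larger value. *)
have /choice[w wP] b : exists w : K * K * X * {ptws I -> R}, B3 b ->
    [/\ coded w.1.1.1 w.2, coded w.1.1.2 w.2, agree D n (\val w.1.1.1) (\val w.1.1.2),
        w.1.2 \in (d b).1.2 & Phi w.1.1.1 w.1.2 + 1 <= Phi w.1.1.2 w.1.2].
  have [B3b|?] := pselect (B3 b); last first.
    (* The default value needs a point of [K]; if there is none, the empty set is the only subset of
       [K] and [B] is countable. *)
    have [[z _]|nK] := pselect (exists z : K, True); first by exists (z, z, 0, 0).
    case: ncB; apply: (@sub_countable _ _ _ [set set0 : set K]) => //.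
    apply: subset_card_le => c _; apply/seteqP; split => // z _.
    by case: nK; exists z.
  have [B2b ndet] := B3b; have [h1 h2 h3 h4] := dP b B2b.
  have [z1 [z2 [x1 [x2 [c1 c2 z12 [b1 nb2]]]]]] : exists z1 z2 x1 x2,
      [/\ coded z1 x1, coded z2 x2, agree D n (\val z1) (\val z2) & b z1 /\ ~ b z2].
    apply: contrapT => h; apply: ndet; split => // z1 z2 x1 x2 c1 c2 z12 b1.
    by apply: contrapT => nb2; apply: h; exists z1, z2, x1, x2.
  have DF : {subset D <= D ++ F0 b} by move=> i iD; rewrite mem_cat iD.
  have [z [z' [x [cz cz' zz' [bz nbz']]]]] :=
    clopen_split_fiber W_gt0 L_inside convL DF h1 c1 c2 z12 b1 nb2.
  have [u us] := h3 z z' bz nbz'; case: (lerP (Phi z u) (Phi z' u)) => h lt1.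
    by exists (z, z', u, x) => _; split => //=; lra.
  exists (z', z, u, x) => _; split => //=; first exact: agree_sym.
  lra.
(* The floor puts all lower values into one interval of length 1/8, and the pattern makes all codes
   share their first [n] digits on [D]. *)
have [[q p] ncB4] := uncountable_pigeonhole
  (fun b => (Num.floor (8 * Phi (w b).1.1.1 (w b).1.2), digit_pattern D n (\val (w b).1.1.1))) ncB3.
set B4 := B3 `&` _ in ncB4.
pose F b := D ++ F0 b.
(* A point of [L] in [U b] can be coded with the initial digits on [F b] of either code in [w b]. *)
pose U b : set {ptws I -> R} := interior [set y : {ptws I -> R} | (forall i, i \in F b ->
   inside (l i) (W i) (digit_row (\val (w b).1.1.1) i) n (y i)) /\
  (forall i, i \in F b -> inside (l i) (W i) (digit_row (\val (w b).1.1.2) i) n (y i))].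
have B4B2 : B4 `<=` B2 by move=> b [[]].
have [|a B4a|s [B4s [nbad linked]]] := @ccc_linked_sequence _ L _ U
    (fun a b => a = b \/ exists i, [/\ i \notin D, i \in F0 a & i \in F0 b]) B4 cccL _ _ ncB4.
- move=> b [B3b _]; split; first exact: open_interior.
  have [c1 c2 _ _ _] := wP b B3b; exists (w b).2; split; first exact: c1.1.
  have FFw : Filter (nbhs (w b).2) by exact: (@nbhs_filter {ptws I -> R} (w b).2).
  by apply: filterI; apply: inside_near => i _; [exact: c1.2|exact: c2.2].
- apply: (@sub_countable _ _ _ (B2 `&` [set b | a = b \/
      exists i, [/\ i \notin D, i \in F0 a & i \in F0 b]])).
    by apply: subset_card_le => b [/B4B2].
  exact: bad_countable.
have wE k : [/\ (w (s k)).1.2 \in (d (s k)).1.2,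
    Phi (w (s k)).1.1.1 (w (s k)).1.2 + 1 <= Phi (w (s k)).1.1.2 (w (s k)).1.2,
    agree D n (\val (w (s k)).1.1.1) (\val (w (s k)).1.1.2),
    Num.floor (8 * Phi (w (s k)).1.1.1 (w (s k)).1.2) = q &
    digit_pattern D n (\val (w (s k)).1.1.1) = p].
  by have [B3s [qE pE]] := B4s k; have [] := wP _ B3s; split.
(* Recoding changes values by less than 1/4: lower values stay below [q / 8 + 1 / 8 + 1 / 4], upper
   ones above [q / 8 + 1 - 1 / 4], which leaves a gap of 3/8. *)
apply: (@contains_l1_of_patterns R X K Phi (fun k => (w (s k)).1.2) (M%:R + 1) C
  (q%:~R / 8 + 3 / 8) (3 / 8)) => //.
- move=> k; have [uk _ _ _ _] := wE k; have [_ _ _ h4] := dP _ (B4B2 _ (B4s k)).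
  by rewrite (le_trans (h4 _ uk))// lerDl.
move=> N e; have [y Ly Uy] := linked N.
have {}Uy k : (k < N)%N -> _ := fun kN => interior_subset (Uy k kN).
pose v k : K := if e k then (w (s k)).1.1.2 else (w (s k)).1.1.1.
have vD j k : agree D n (\val (v j)) (\val (v k)).
  have a0 k' : agree D n (\val (v k')) (\val (w (s k')).1.1.1).
    have [_ _ a _ _] := wE k'; rewrite /v; case: (e k') => //; exact: agree_sym.
  have [_ _ _ _ pj] := wE j; have [_ _ _ _ pk] := wE k.
  apply: agree_trans (a0 j) _; apply: agree_trans (agree_sym (a0 k)).
  by apply: digit_pattern_agree; rewrite pj pk.
(* [Y] takes its digits at [i] from the first set of the sequence whose support contains [i]. There
   is no conflict: on [D] all codes agree, and off [D] the supports are disjoint. *)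
pose c i := find (fun k => i \in F (s k)) (iota 0 N).
pose Y : {ptws I * nat -> bool} := fun pp => \val (v (c pp.1)) pp.
have YP k : (k < N)%N -> agree (F (s k)) n Y (\val (v k)).
  move=> kN i t iF tn; rewrite /Y /=.
  have hk : has (fun k => i \in F (s k)) (iota 0 N).
    by apply/hasP; exists k => //; rewrite mem_iota.
  have := nth_find 0 hk; rewrite -/(c i).
  have cN : (c i < N)%N by move: hk; rewrite has_find size_iota.
  rewrite nth_iota// add0n => iFc.
  have [iD|iD] := boolP (i \in D); first exact: vD.
  have i0 j : i \in F (s j) -> i \in F0 (s j) by rewrite mem_cat (negbTE iD).
  have [ck|kc|->//] := ltngtP (c i) k; exfalso.
    by apply: (nbad _ _ ck); right; exists i; split => //; exact: i0.
  by apply: (nbad _ _ kc); right; exists i; split => //; exact: i0.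
(* A single code of the common point [y] follows all the chosen codes at once. *)
have [z0 [z0y z0Y]] := coded_exists W_gt0 L_inside Y n Ly.
have [z zE] := coded_sub z0y; exists z => k kN.
have zv : agree (F (s k)) n (\val z) (\val (v k)).
  rewrite zE; apply: agree_trans (YP k kN); apply: z0Y => i iF.
  apply: (agree_inside (agree_sym (YP k kN)) iF).
  by have [h1 h2] := Uy k kN; rewrite /v; case: (e k); [exact: h2|exact: h1].
have [uk gap _ qE _] := wE k; have [_ h2 _ _] := dP _ (B4B2 _ (B4s k)).
have := h2 _ _ zv _ uk; rewrite ltr_norml /v.
have := floor_itv (8 * Phi (w (s k)).1.1.1 (w (s k)).1.2); rewrite qE intrD.
by case: (e k) => /andP[? ?] /andP[? ?]; lra.
Qed.

End uncountable_clopen_families.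

(** The uniform boundedness principle on the complete space [X], followed by scaling to the unit
    sphere. *)
Lemma dual_elts_bounded (R : realType) (X : completeNormedModType R) (T : Type)
    (Phi : T -> X -> R) :
  (forall z, dual_elt (Phi z)) -> (forall u, exists M, forall z, `|Phi z u| <= M) ->
  exists2 C, 0 < C & forall z u, `|Phi z u| <= C * `|u|.
Proof.
move=> dPhi bPhi.
have [|x|M PhiM] := @Banach_Steinhauss R X R (range Phi) _ _ 1.
- move=> _ [z _ <-]; have [aPhi [sPhi cPhi]] := dPhi z.
  have lin : linear (Phi z : X -> R) by move=> a u v; rewrite aPhi sPhi.
  split => //.
  pose f : {linear X -> R} := HB.pack (Phi z : X -> R) (GRing.isLinear.Build _ _ _ _ _ lin).
  exact: (bounded_funP f).2 ((linear_bounded_continuous f).2 cPhi).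
- by have [M PM] := bPhi x; exists M => _ [z _ <-].
exists (`|M| + 1) => [|z u]; first by rewrite ltr_wpDl.
have [->|u0] := eqVneq u 0.
  have [aPhi _] := dPhi z; have := aPhi 0 0; rewrite addr0 => /eqP.
  by rewrite -subr_eq subrr eq_sym => /eqP ->; rewrite !normr0 mulr0.
have nu : 0 < `|u| by rewrite normr_gt0.
have [_ [sPhi _]] := dPhi z.
have : `|Phi z (`|u|^-1 *: u)| <= M.
  apply: PhiM; first by exists z.
  by rewrite normrZ normfV normr_id mulVf ?gt_eqF.
rewrite sPhi normrM normfV normr_id ler_pdivrMl// mulrC => h.
by rewrite (le_trans h)// ler_wpM2r// (le_trans (ler_norm M))// lerDl ler01.
Qed.

(** * WRN subalgebras *)

Section stone_points.
Context (K : topologicalType) (B : set (set K)).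
Hypothesis subB : clopen_subalgebra B.

(** The canonical map to the Stone space, a point going to its principal ultrafilter; the conjunct
    [B b] follows the convention that homomorphisms vanish outside [B]. *)
Definition stone_point (z : K) : {ptws set K -> bool} := fun b => `[< B b /\ b z >].

Lemma stone_point_mem z : stone_space B (stone_point z).
Proof.
have [_ [_ [BT [BC [BU BI]]]]] := subB; rewrite /stone_space /stone_point /=.
split; [exact/asboolP|split; [|split; [|split]]].
- move=> b Bb; apply/asboolP/negP => [[_ nbz] /asboolP[]//|h]; split; first exact: BC.
  by move=> bz; apply: h; apply/asboolP.
- move=> b c Bb Bc; apply/asboolP/orP => [[_ [bz|cz]]|].
  + by left; apply/asboolP.
  + by right; apply/asboolP.
  + by move=> [/asboolP[_ ?]|/asboolP[_ ?]]; (split; [exact: BU|]); [left|right].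
- move=> b c Bb Bc; apply/asboolP/andP => [[_ [bz cz]]|].
  + by split; apply/asboolP.
  + by move=> [/asboolP[_ ?] /asboolP[_ ?]]; split; [exact: BI|split].
- by move=> b nBb; apply/asboolP => -[].
Qed.

Lemma stone_point_continuous : continuous stone_point.
Proof.
move=> z; have FFz : Filter (stone_point @ z) by exact: fmap_filter.
apply: (@ptws_cvg (set K) bool _ (stone_point z) FFz) => b A /nbhs_singleton Ab.
have [Bb|nBb] := pselect (B b); last first.
  apply: (@filterS _ (nbhs z) _ setT); last exact: filterT.
  move=> z' _; rewrite /= /stone_point in Ab *.
  by rewrite (_ : `[< B b /\ b z' >] = `[< B b /\ b z >])//; apply/asbool_equiv_eq; split => -[].
have [ob cb] := subB.1 b Bb.
have [bz|nbz] := pselect (b z).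
  apply: (@filterS _ (nbhs z) _ b); last exact: open_nbhs_nbhs.
  move=> z' bz'; move: Ab; rewrite /= /stone_point.
  by rewrite (_ : `[< B b /\ b z' >] = `[< B b /\ b z >])//; apply/asbool_equiv_eq; split => -[].
apply: (@filterS _ (nbhs z) _ (~` b)); last first.
  by apply: open_nbhs_nbhs; split => //; exact: closed_openC.
move=> z' nbz'; move: Ab; rewrite /= /stone_point.
by rewrite (_ : `[< B b /\ b z' >] = `[< B b /\ b z >])//; apply/asbool_equiv_eq; split => -[].
Qed.

Lemma stone_point_sep b z z' : B b -> b z -> ~ b z' -> stone_point z <> stone_point z'.
Proof.
move=> Bb bz nbz' e; have : stone_point z' b by rewrite -e; apply/asboolP.
by move=> /asboolP[].
Qed.

End stone_points.

(** An embedding [f] of the Stone space composed with [stone_point] yields a bounded, pointwise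
    continuous family of functionals on [X] that separates each member of [B] from its complement;
    an uncountable [B] would then force a copy of l1 in [X]. *)
Lemma code_space_WRNB_perp (R : realType) (I : choiceType) (L : set {ptws I -> R})
    (l W : I -> R) :
  (forall i, 0 < W i) -> (forall x, L x -> forall i, l i < x i < l i + W i) ->
  convex_set L -> ccc_set L -> WRNB_perp R (code_space L l W).
Proof.
move=> W0 Ll cvL cccL B subB [X [f [g [nl1 [df [_ [cf [_ gf]]]]]]]].
apply: contrapT => ncB; apply: nl1.
pose Phi (z : code_space L l W) (u : X) : R := f (stone_point B z) u.
have cPhi u : continuous (Phi^~ u).
  move=> z; have /subspace_continuousP := cf.
  move=> /(_ _ (stone_point_mem subB z)) cfz A nA.
  have [E nE EA] : exists2 E, nbhs (f (stone_point B z)) E & E `<=` [set h | A (h u)].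
    exists [set h | A (h u)] => //.
    exact: (@ptws_eval_continuous {classic X} R u (f (stone_point B z)) A nA).
  have := cfz E nE; rewrite /fmap /= /within /= => /(stone_point_continuous subB) nE'.
  apply: (@filterS _ (nbhs z) _ _ _ _ nE') => z' h; apply: EA; apply: h; exact: stone_point_mem.
have [C C0 PhiC] : exists2 C, 0 < C & forall z u, `|Phi z u| <= C * `|u|.
  apply: dual_elts_bounded => [z|u]; first exact/df/stone_point_mem.
  have := @continuous_compact _ _ (Phi^~ u) setT.
  move=> /(_ (continuous_subspaceT (cPhi u)) (code_space_compact L l W).2).
  move=> /compact_bounded[M [_ hM]]; exists (M + 1) => z.
  by apply: (hM (M + 1)); rewrite ?ltrDl//; exists z.
have dP z : dual_elt (Phi z) by exact/df/stone_point_mem.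
apply: (@uncountable_clopens_contain_l1 R I L l W W0 Ll cvL cccL X Phi C B) => //.
- by move=> z; have [] := dP z.
- by move=> z; have [_ []] := dP z.
- exact: subB.1.
(* If all vectors agreed at [z] and [z'], the left inverse [g] would identify two Stone points that
   [b] distinguishes. *)
move=> b z z' Bb bz nbz'; apply: contrapT => h.
apply: (stone_point_sep Bb bz nbz').
rewrite -(gf _ (stone_point_mem subB z)) -(gf _ (stone_point_mem subB z')).
congr g; apply/funext => u; apply: contrapT => hu; apply: h; by exists u.
Qed.

(** * Bounded coordinates and the surjection *)

Lemma ptws_compact_bounded (R : realType) (I : choiceType) (L : set {ptws I -> R}) (i : I) :
  compact L -> exists2 M, 0 < M & forall x, L x -> `|x i| < M.
Proof.
move=> cL; have := @continuous_compact _ _ (fun x : {ptws I -> R} => x i) L.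
move=> /(_ (continuous_subspaceT (@ptws_eval_continuous I R i)) cL).
move=> /compact_bounded[M [_ hM]]; exists (`|M| + 2) => [|x Lx].
  by rewrite ltr_wpDl.
have : `|x i| <= `|M| + 1.
  by apply: hM; [rewrite ltr_pwDr// ler_norm|exists x].
move=> /le_lt_trans; apply; lra.
Qed.

Unset Implicit Arguments.

Theorem theorem6p2 (R : realType) (I : Type) (L : set {ptws I -> R}) :
  compact L -> convex_set L -> ccc_set L ->
  exists (K : topologicalType) (f : K -> {ptws I -> R}),
    compact_space K /\ zero_dim K /\ WRNB_perp R K /\
    continuous f /\ f @` setT = L.
Proof.
(* The index type may be arbitrary, since classically it carries a choice structure. *)
suff main (J : choiceType) (L' : set {ptws J -> R}) :
    compact L' -> convex_set L' -> ccc_set L' ->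
    exists (K : topologicalType) (f : K -> {ptws J -> R}),
      compact_space K /\ zero_dim K /\ WRNB_perp R K /\
      continuous f /\ f @` setT = L'.
  exact: (main {classic I} L).
move=> cL cvL cccL.
have /choice[M MP] i : exists M, 0 < M /\ forall x, L' x -> `|x i| < M.
  by have [M] := ptws_compact_bounded i cL; exists M.
(* The initial interval runs from [- M i] to [M i], so the strict bound puts all coordinates
   strictly inside. *)
pose l i := - M i; pose W i := M i *+ 2.
have W0 i : 0 < W i by rewrite pmulrn_lgt0//; exact: (MP i).1.
have Ll x : L' x -> forall i, l i < x i < l i + W i.
  move=> Lx i; have := (MP i).2 x Lx; rewrite ltr_norml /l /W => /andP[? ?].
  by apply/andP; split; lra.
exists (code_space L' l W), (fun z => decode l W (\val z)).
split; first exact: code_space_compact.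
split; first exact: sub_zero_dim.
split; first exact: code_space_WRNB_perp.
split.
  move=> z; apply: continuous_comp; first exact: sub_val_continuous.
  exact: decode_continuous.
have hR : hausdorff_space {ptws J -> R}.
  by apply: (@hausdorff_product J (fun=> R)) => _; exact: Rhausdorff.
rewrite -[RHS](decode_image W0 Ll (compact_closed hR cL)).
apply/seteqP; split => [_ [z _ <-]|_ [z Kz <-]].
  by exists (\val z) => //; exact: set_valP.
by exists (exist _ z (mem_set Kz)).
Qed.
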